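(* For all $\tau\in\{0,1\}^{\mathbb N}$, for all $y\in Y_\tau$, for all $L\ge1$, there exists $i\in\{0,\dots,3^L-1\}$ such that $$y=S^i\,\varphi_{\tau_0}\circ\varphi_{\tau_1}\circ\cdots\circ\varphi_{\tau_{L-1}}\bigl(\Delta^L y\bigr).$$
   Context: Conventions: $\mathbb N=\{0,1,2,\dots\}$; $S$ is the shift, $(Sx)_n=x_{n+1}$. Smooth sequences. A mono-symbol block of $x\in\{1,3\}^{\mathbb Z}$ is a maximal run of equal consecutive symbols. If all mono-symbol blocks of $x$ are finite, $\Delta x$ is the bi-infinite sequence of lengths of the consecutive mono-symbol blocks of $x$, indexed so that $(\Delta x)_0$ is the length of the block containing position $0$. $x$ is smooth if $\Delta^k x$ is well-defined and in $\{1,3\}^{\mathbb Z}$ for all $k\ge0$. $X$ is the set of bi-infinite smooth sequences. Recoding. Let $\mathcal A=\{\mathtt A,\mathtt B,\mathtt C,\mathtt D\}$ encode the blocks $\mathtt A=1$, $\mathtt B=3$, $\mathtt C=111$, $\mathtt D=333$. For $x\in X$, $\mathrm{rec}(x)\in\mathcal A^{\mathbb Z}$ is the sequence of codes of the consecutive mono-symbol blocks of $x$, with $\mathrm{rec}(x)_0$ the code of the block containing $x_0$; $Y=\mathrm{rec}(X)$. The derivative on $Y$ is defined by $\Delta(\mathrm{rec}(x)):=\mathrm{rec}(\Delta x)$. Each letter of $y=\mathrm{rec}(x)$ corresponds to one letter of $\Delta x$. The factor of $y$ corresponding to a mono-symbol block of $\Delta x$ is called an elementary block of $y$: the block $1$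 gives $\mathtt A$ or $\mathtt B$; $3$ gives $\mathtt C$ or $\mathtt D$; $111$ gives $\mathtt{ABA}$ or $\mathtt{BAB}$; $333$ gives $\mathtt{CDC}$ or $\mathtt{DCD}$. Types. $y=\mathrm{rec}(x)\in Y$ (and $x$) has type $0$ if $y$ contains an elementary block in $\{\mathtt{ABA},\mathtt{DCD}\}$, and type $1$ if it contains an elementary block in $\{\mathtt{BAB},\mathtt{CDC}\}$; every $y\in Y$ has exactly one type. $\mathrm{Types}(y)=(\mathrm{type}(\Delta^n y))_{n\in\mathbb N}$, and $Y_\tau=\{y\in Y:\mathrm{Types}(y)=\tau\}$. Substitutions. $\varphi_0:\ \mathtt A\mapsto\mathtt A,\ \mathtt B\mapsto\mathtt D,\ \mathtt C\mapsto\mathtt{ABA},\ \mathtt D\mapsto\mathtt{DCD}$; $\varphi_1:\ \mathtt A\mapsto\mathtt B,\ \mathtt B\mapsto\mathtt C,\ \mathtt C\mapsto\mathtt{BAB},\ \mathtt D\mapsto\mathtt{CDC}$. They act on bi-infinite sequences by concatenation, $\varphi_t(y)=\cdots\varphi_t(y_{-1})\varphi_t(y_0)\varphi_t(y_1)\cdots$, indexed so that the block $\varphi_t(y_0)$ begins at index $0$. *)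

(* Defs.v *)
From HB Require Import structures.
From mathcomp Require Import all_boot all_order all_algebra.
From mathcomp Require Import boolp classical_sets.
From mathcomp Require Import zify.

Set Implicit Arguments.
Unset Strict Implicit.
Unset Printing Implicit Defensive.

Import Order.TTheory GRing.Theory Num.Theory.
Local Open Scope ring_scope.
Local Open Scope classical_set_scope.

Definition shift (T : Type) (x : int -> T) : int -> T := fun n => x (n + 1).

(* The factor x_a x_(a+1) ... x_(b-1), for a <= b. *)
Definition factor (T : Type) (x : int -> T) (a b : int) : seq T :=
  [seq x (a + k%:Z) | k <- iota 0 `|b - a|%N].

(** Smooth sequences *)

(* The half-open interval [a, b) carries a finite mono-symbol block of x. *)
Definition mono_block (x : int -> nat) (a b : int) : Prop :=
  [/\ a < b, forall i, a <= i < b -> x i = x a, x (a - 1) <> x a & x b <> x a].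

Definition finite_blocks (x : int -> nat) : Prop :=
  forall i, exists a b, a <= i < b /\ mono_block x a b.

(* The n-th mono-symbol block of x is [c n, c (n + 1)), block 0 being the one
   that contains position 0. *)
Definition is_cuts (x : int -> nat) (c : int -> int) : Prop :=
  c 0 <= 0 < c 1 /\ forall n, mono_block x (c n) (c (n + 1)).

(* If all mono-symbol blocks of x are finite, there is exactly one such c
   (lemmas cutsP and is_cuts_unique); the default value is never used. *)
Definition cuts (x : int -> nat) : int -> int :=
  xget (fun _ : int => 0 : int) [set c | is_cuts x c].

Definition delta (x : int -> nat) : int -> nat :=
  fun n => `|cuts x (n + 1) - cuts x n|%N.

Definition in13 (x : int -> nat) : Prop := forall n, x n = 1%N \/ x n = 3%N.

(* Finiteness of the blocks of every iterate is what makes all the iterates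
   well-defined. *)
Definition smooth (x : int -> nat) : Prop :=
  forall k, in13 (iter k delta x) /\ finite_blocks (iter k delta x).

Definition X : set (int -> nat) := [set x | smooth x].

(** Recoding *)

Inductive letter : Type := LA | LB | LC | LD.

(* The block made of [len] copies of [s]; only s, len in {1, 3} matter. *)
Definition code (s len : nat) : letter :=
  if len == 1%N then (if s == 1%N then LA else LB)
  else (if s == 1%N then LC else LD).

Definition rec (x : int -> nat) : int -> letter :=
  fun n => code (x (cuts x n)) (delta x n).

Definition Y : set (int -> letter) := rec @` X.

(* The derivative on Y, through a chosen preimage under rec; the choice is
   immaterial (lemma deltaY_rec). *)
Definition deltaY (y : int -> letter) : int -> letter :=
  rec (delta (xget (fun _ : int => 0%N) [set x | X x /\ rec x = y])).

(** Types; the type 0 is encoded by false, the type 1 by true. *)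

Definition elementary_block (y : int -> letter) (w : seq letter) : Prop :=
  exists x a b,
    [/\ X x, rec x = y, mono_block (delta x) a b & w = factor y a b].

Definition has_type (y : int -> letter) (t : bool) : Prop :=
  if t then elementary_block y [:: LB; LA; LB] \/
            elementary_block y [:: LC; LD; LC]
  else elementary_block y [:: LA; LB; LA] \/
       elementary_block y [:: LD; LC; LD].

Definition has_types (y : int -> letter) (tau : nat -> bool) : Prop :=
  forall n, has_type (iter n deltaY y) (tau n).

Definition Yt (tau : nat -> bool) : set (int -> letter) :=
  [set y | Y y /\ has_types y tau].

(** Substitutions *)

Definition phi (t : bool) (l : letter) : seq letter :=
  match t, l with
  | false, LA => [:: LA]
  | false, LB => [:: LD]
  | false, LC => [:: LA; LB; LA]
  | false, LD => [:: LD; LC; LD]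
  | true, LA => [:: LB]
  | true, LB => [:: LC]
  | true, LC => [:: LB; LA; LB]
  | true, LD => [:: LC; LD; LC]
  end.

(* ... phi_t(y_-1) . phi_t(y_0) phi_t(y_1) ..., index 0 being just after the
   dot.  As no phi_t(l) is empty, the entry of index m >= 0 is found in
   phi_t(y_0) ... phi_t(y_m), and the entry of index Negz m = -(m+1) is the
   m-th one, from 0 and read from right to left, of
   phi_t(y_-(m+1)) ... phi_t(y_-1). *)
Definition subst (t : bool) (y : int -> letter) : int -> letter := fun i =>
  match i with
  | Posz m => nth LA (flatten [seq phi t (y (Posz k)) | k <- iota 0 m.+1]) m
  | Negz m =>
      nth LA (flatten [seq rev (phi t (y (Negz k))) | k <- iota 0 m.+1]) m
  end.

(* phi_(tau_0) o ... o phi_(tau_(L-1)) *)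
Fixpoint substs (tau : nat -> bool) (L : nat) (y : int -> letter) :
    int -> letter :=
  if L is L'.+1 then substs tau L' (subst (tau L') y) else y.

(** The default values and the choices above are immaterial *)

Lemma mono_block_unique x a b a' b' i : mono_block x a b -> mono_block x a' b' ->
  a <= i < b -> a' <= i < b' -> a = a' /\ b = b'.
Proof.
move=> [ab xab xa xb] [ab' xab' xa' xb'] iab iab'.
have xaa' : x a = x a' by rewrite -(xab i) // -(xab' i).
split.
- case: (ltgtP a a') => // h.
  + by case: xa'; rewrite -xaa'; apply: xab; lia.
  + by case: xa; rewrite xaa'; apply: xab'; lia.
- case: (ltgtP b b') => // h.
  + by case: xb; rewrite xaa'; apply: xab'; lia.
  + by case: xb'; rewrite -xaa'; apply: xab; lia.
Qed.

Lemma is_cuts_unique x c c' : is_cuts x c -> is_cuts x c' -> c = c'.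
Proof.
move=> [c0 cb] [c0' cb']; apply/funext.
elim/int_rec => [|n IHn|n IHn].
- have /= h := cb 0; have /= h' := cb' 0; rewrite add0r in h h'.
  by case: (mono_block_unique h h' c0 c0').
- have h := cb n%:Z; have h' := cb' n%:Z.
  have E : n%:Z + 1 = n.+1%:Z by lia.
  rewrite E in h h'; have [? _ _ _] := h; have [? _ _ _] := h'.
  by have [] := mono_block_unique h h' (i := c n%:Z) ltac:(lia) ltac:(lia).
- have h := cb (- n.+1%:Z); have h' := cb' (- n.+1%:Z).
  have E : - n.+1%:Z + 1 = - n%:Z by lia.
  rewrite E in h h'; have [? _ _ _] := h; have [? _ _ _] := h'.
  by have [] := mono_block_unique h h' (i := c (- n%:Z) - 1) ltac:(lia) ltac:(lia).
Qed.

Lemma is_cuts_exists x : finite_blocks x -> exists c, is_cuts x c.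
Proof.
move=> fx; have [s sP] := choice fx; have [e eP] := choice sP.
pose st p := x (p - 1) <> x p.
have st_s i : st (s i) by case: (eP i) => _ [].
have st_e i : st (e i).
  have [ie [se xse _ xe]] := eP i; rewrite /st xse; last by lia.
  by move=> /esym.
have fwd p : st p -> mono_block x p (e p).
  move=> stp; have [ie B] := eP p; have [_ xse _ _] := B.
  suff E : s p = p by rewrite E in B.
  case: (ltgtP (s p) p) => // h; last by lia.
  by case: stp; rewrite !xse //; lia.
have bwd p : st p -> mono_block x (s (p - 1)) p.
  move=> stp; have [ie B] := eP (p - 1); have [_ xse _ _] := B.
  suff E : e (p - 1) = p by rewrite E in B.
  case: (ltgtP (e (p - 1)) p) => // h; first by lia.
  by case: stp; rewrite !xse //; lia.
pose c i := match i with
  | Posz n => iter n e (s 0)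
  | Negz n => iter n.+1 (fun p => s (p - 1)) (s 0)
  end.
have st_c n : st (c n) by case: n => [[|n]|n] /=; do ?[exact: st_s|exact: st_e].
exists c; split.
- have [h0 B0] := eP 0; have [? _ _ _] := B0.
  have Bs := fwd (s 0) (st_s 0).
  have [h _ _ _] := Bs.
  have [_ E] := mono_block_unique B0 Bs (i := s 0) ltac:(lia) ltac:(lia).
  by rewrite /= -E.
- case=> [n|n].
  + by rewrite (_ : n%:Z + 1 = n.+1%:Z); [exact/fwd/(st_c n%:Z) | lia].
  + case: n => [|n]; first exact/bwd/(st_c 0).
    rewrite (_ : Negz n.+1 + 1 = Negz n); last by rewrite !NegzE; lia.
    exact/bwd/(st_c (Negz n)).
Qed.

Lemma cutsP x : finite_blocks x -> is_cuts x (cuts x).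
Proof. by move=> /is_cuts_exists; exact: xgetPex. Qed.

Lemma deltaY_rec x : X x -> deltaY (rec x) = rec (delta x).
Proof.
move=> Xx; rewrite /deltaY; congr (rec _).
have : exists x', [set x' | X x' /\ rec x' = rec x] x' by exists x.
move=> /(xgetPex (fun _ : int => 0%N)); set x' := xget _ _ => -[Xx' E].
apply/funext => n; have := congr1 (fun y => y n) E; rewrite /rec /code.
case: (Xx' 0%N) => _ fx'; case: (Xx 0%N) => _ fx.
have [/= + _] := Xx' 1%N; have [/= + _] := Xx 1%N.
by move=> /(_ n)[] -> /(_ n)[] -> //=; do 2 case: ifP.
Qed.

(* Main.v *)
(** Let [d] be the derivative of [x] and [y = rec x].  Along the blocks of [x]
    the symbols alternate, and so do the symbols of [d] along its own blocks.
    Since the blocks of [d] have odd length, whether the first letter of an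
    elementary block of [y] codes a block of [x] whose symbol equals its length
    is the same for all elementary blocks: the type [t] records exactly this.
    Hence each elementary block of [y] is the image by [phi t] of the
    corresponding letter of the derivative of [y], and [y] is a shift of
    [subst t (deltaY y)] by at most 2.  The case of general [L] follows by
    induction: a substituted letter has at most 3 letters, so a shift by [j]
    moved across [L] substitutions becomes a shift by at most [3 ^ L * j], and
    [i + 2 * 3 ^ L < 3 ^ L.+1] when [i < 3 ^ L]. *)
Require Import Defs.
From mathcomp Require Import all_boot all_order all_algebra.
From mathcomp Require Import boolp classical_sets.
From mathcomp Require Import zify.

Import Order.TTheory GRing.Theory Num.Theory.
Local Open Scope ring_scope.

(** * Induction and indexing over the integers *)

Lemma int_step_ind (P : int -> Prop) (m : int) :
  P m -> (forall n, P n <-> P (n + 1)) -> forall n, P n.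
Proof.
move=> Pm PS.
have up k : P (m + k%:Z).
  elim: k => [|k IHk]; first by rewrite addr0.
  by have /PS := IHk; rewrite (_ : _ + 1 = m + k.+1%:Z) //; lia.
have down k : P (m - k%:Z).
  elim: k => [|k IHk]; first by rewrite subr0.
  by apply/PS; rewrite (_ : _ + 1 = m - k%:Z) //; lia.
move=> n; case: (lerP m n) => h.
  by rewrite (_ : n = m + `|n - m|%N%:Z); [exact: up | lia].
by rewrite (_ : n = m - `|n - m|%N%:Z); [exact: down | lia].
Qed.

(** When [i] moves by one, it stays in its interval or enters an adjacent one, so the existence of
    [n] passes both ways between [i] and [i + 1]. *)
Lemma increasing_int_cover (e : int -> int) : (forall n, e n < e (n + 1)) ->
  forall i, exists n, e n <= i < e (n + 1).
Proof.
move=> eS; apply: (int_step_ind _ (e 0)); first by exists 0; rewrite lexx eS.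
move=> i; split=> -[n /andP[ni iS]].
  have [h|h] := ltrP (i + 1) (e (n + 1)); first by exists n; lia.
  by exists (n + 1); have := eS (n + 1); lia.
have [h|h] := lerP (e n) i; first by exists n; lia.
by exists (n - 1); rewrite subrK; have := eS (n - 1); rewrite subrK; lia.
Qed.

Lemma iter_shift (T : Type) (x : int -> T) i n :
  iter i (@shift T) x n = x (n + i%:Z).
Proof.
elim: i n => [|i IHi] n /=; first by rewrite addr0.
by rewrite /shift IHi; congr (x _); lia.
Qed.

(** * Positions inside a substituted sequence *)

(** As no word is empty, [k] words have total length at least [k], so word [k] is among the first
    [m.+1]: the truncation in [subst] is long enough. *)
Lemma nth_flatten_prefix (T : Type) (x0 : T) (f : nat -> seq T) k j :
  (forall k, (0 < size (f k))%N) -> (j < size (f k))%N ->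
  let m := (size (flatten [seq f k | k <- iota 0 k]) + j)%N in
  nth x0 (flatten [seq f k | k <- iota 0 m.+1]) m = nth x0 (f k) j.
Proof.
move=> f_gt0 jk m.
have km : (k <= m)%N.
  rewrite /m; apply: leq_trans (leq_addr _ _).
  elim: (k) => // l IHl; rewrite -addn1 iotaD map_cat flatten_cat size_cat /=.
  by rewrite cats0 leq_add.
rewrite (_ : m.+1 = (k + (m - k).+1)%N); last by lia.
rewrite iotaD map_cat flatten_cat nth_cat ltnNge leq_addr /= add0n nth_cat.
by rewrite addKn jk.
Qed.

Lemma size_phi t l : (0 < size (phi t l) <= 3)%N.
Proof. by case: t l => -[]. Qed.

(** The index at which the image of [z n] begins in [subst t z]. *)
Definition phi_start (t : bool) (z : int -> letter) (n : int) : int :=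
  match n with
  | Posz m => (size (flatten [seq phi t (z (Posz k)) | k <- iota 0 m]))%:Z
  | Negz m =>
      - (size (flatten [seq rev (phi t (z (Negz k))) | k <- iota 0 m.+1]))%:Z
  end.

Lemma phi_startS t z n :
  phi_start t z (n + 1) = phi_start t z n + (size (phi t (z n)))%:Z.
Proof.
case: n => [n|[|n]].
- rewrite (_ : n%:Z + 1 = n.+1%:Z); last by lia.
  by rewrite /phi_start -addn1 iotaD map_cat flatten_cat size_cat /= cats0.
- by rewrite (_ : Negz 0 + 1 = 0) //= cats0 size_rev; lia.
- rewrite (_ : Negz n.+1 + 1 = Negz n); last by rewrite !NegzE; lia.
  rewrite /phi_start -[n.+2]addn1 iotaD map_cat flatten_cat size_cat /= cats0.
  by rewrite add0n size_rev; lia.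
Qed.

Lemma subst_phi_start t z n k : (k < size (phi t (z n)))%N ->
  subst t z (phi_start t z n + k%:Z) = nth LA (phi t (z n)) k.
Proof.
case: n => m kz.
  rewrite [phi_start _ _ _]/phi_start -PoszD /subst.
  apply: (@nth_flatten_prefix _ LA (fun k => phi t (z (Posz k)))) => // l.
  by case/andP: (size_phi t (z l)).
pose f l := rev (phi t (z (Negz l))).
set s := size (phi t (z (Negz m))) in kz.
(* Left of index 0 the words are read reversed: letter [k] of a word of length [s] becomes letter
   [s - k.+1]. *)
have -> : phi_start t z (Negz m) + k%:Z =
    Negz (size (flatten [seq f l | l <- iota 0 m]) + (s - k.+1))%N.
  rewrite /phi_start -[m.+1]addn1 iotaD map_cat flatten_cat size_cat /= cats0.
  by rewrite add0n size_rev -/s NegzE;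
    set p := size (flatten [seq f l | l <- iota 0 m]); lia.
rewrite /subst (@nth_flatten_prefix _ LA f).
- by rewrite /f nth_rev -/s; [congr nth|]; lia.
- by move=> l; rewrite /f size_rev; case/andP: (size_phi t (z (Negz l))).
- by rewrite /f size_rev -/s; lia.
Qed.

(** The cut points [e] have the same gaps as [phi_start t z], hence differ from it by the constant
    [e 0]; the images then cover all indices. *)
Lemma subst_unique t z w (e : int -> int) :
  (forall n, e (n + 1) = e n + (size (phi t (z n)))%:Z) ->
  (forall n k, (k < size (phi t (z n)))%N ->
    w (e n + k%:Z) = nth LA (phi t (z n)) k) ->
  forall i, w (e 0 + i) = subst t z i.
Proof.
move=> eS we i.
have eE : forall n, e n = e 0 + phi_start t z n.
  apply: (int_step_ind _ 0) => [|n]; first by rewrite addr0.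
  by rewrite eS phi_startS; split; lia.
have startS n : phi_start t z n < phi_start t z (n + 1).
  by rewrite phi_startS; have := size_phi t (z n); lia.
have [n] := increasing_int_cover _ startS i; rewrite phi_startS => ni.
have -> : i = phi_start t z n + `|i - phi_start t z n|%N%:Z by lia.
rewrite addrA -eE we; last by lia.
by rewrite subst_phi_start //; lia.
Qed.

(** * Moving shifts across substitutions *)

Lemma subst_shift t z :
  subst t (shift z) = iter (size (phi t (z 0))) (@shift letter) (subst t z).
Proof.
apply/funext => i; rewrite iter_shift.
rewrite -(@subst_unique t (shift z) (subst t z)
  (fun n => phi_start t z (n + 1))).
- by rewrite phi_startS addrC /= add0r.
- by move=> n; rewrite phi_startS.
- by move=> n k kz; rewrite subst_phi_start.
Qed.

Lemma subst_iter_shift t z j : exists2 k, (k <= 3 * j)%N &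
  subst t (iter j (@shift letter) z) = iter k (@shift letter) (subst t z).
Proof.
elim: j => [|j [k kj IHj]]; first by exists 0%N.
rewrite iterS subst_shift IHj -iterD; eexists; last by [].
by have := size_phi t (iter j (@shift letter) z 0); lia.
Qed.

Lemma substs_iter_shift tau L z j : exists2 k, (k <= 3 ^ L * j)%N &
  substs tau L (iter j (@shift letter) z) =
  iter k (@shift letter) (substs tau L z).
Proof.
elim: L z j => [|L IHL] z j; first by exists j; rewrite ?expn0 ?mul1n.
have [k kj /= ->] := subst_iter_shift (tau L) z j.
have [l lk ->] := IHL (subst (tau L) z) k; exists l => //.
by rewrite (leq_trans lk) // expnSr -mulnA leq_mul2l kj orbT.
Qed.

(** * Elementary blocks of a recoded smooth sequence *)

Lemma cuts_delta x (n : int) : finite_blocks x ->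
  cuts x (n + 1) = cuts x n + (delta x n)%:Z.
Proof. by move=> /cutsP[_ /(_ n)[h _ _ _]]; rewrite /delta; lia. Qed.

Lemma cuts_alternate x (n : int) : in13 x -> finite_blocks x ->
  x (cuts x (n + 1)) = (4 - x (cuts x n))%N.
Proof.
move=> x13 /cutsP[_ /(_ n)[_ _ _]].
by case: (x13 (cuts x n)) (x13 (cuts x (n + 1))) => -> [] ->.
Qed.

Lemma rec_elementary_block x t : smooth x ->
  (exists n, let a := cuts (delta x) n in
    (x (cuts x a) == delta x a) = ~~ t) ->
  forall (n : int) k, let d := delta x in
    (k < delta d n)%N ->
    rec x (cuts d n + k%:Z) = nth LA (phi t (rec d n)) k.
Proof.
move=> sx [m tm] n k d kn; rewrite /= in tm.
have [x13 fx] := sx 0%N; have [d13 fd] := sx 1%N; have [d213 _] := sx 2%N.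
rewrite /= in x13 fx d13 fd d213; rewrite -/d in tm d13 fd d213.
pose s i := x (cuts x i).
have s13 i : s i = 1%N \/ s i = 3%N by exact: x13.
have sS i : s (i + 1) = (4 - s i)%N by exact: cuts_alternate.
(* From one elementary block to the next, both sides turn into 4 minus themselves: [d] changes
   symbol, and [s] alternates 1 or 3 times, an odd number. *)
have tn : (s (cuts d n) == d (cuts d n)) = ~~ t.
  apply: (int_step_ind
    (fun n => (s (cuts d n) == d (cuts d n)) = ~~ t) m) => //.
  move=> i; rewrite cuts_alternate // cuts_delta //.
  have -> : s (cuts d i + (delta d i)%:Z) = (4 - s (cuts d i))%N.
    case: (d213 i) => ->; first exact: sS.
    rewrite (_ : _ + _ = cuts d i + 1 + 1 + 1); last by lia.
    by rewrite !sS; case: (s13 (cuts d i)) => ->.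
  by case: (s13 (cuts d i)) (d13 (cuts d i)) => -> [] ->.
have dk : d (cuts d n + k%:Z) = d (cuts d n).
  have [_ /(_ n)[_ h _ _]] := cutsP fd; apply: h.
  by rewrite cuts_delta //; lia.
rewrite /rec -/(s _) -/d dk.
have k3 : (k < 3)%N by case: (d213 n) kn => ->; lia.
have sE1 : s (cuts d n + 1) = (4 - s (cuts d n))%N by exact: sS.
have sE2 : s (cuts d n + 2) = s (cuts d n).
  rewrite (_ : cuts d n + 2 = cuts d n + 1 + 1); last by lia.
  by rewrite !sS; case: (s13 (cuts d n)) => ->.
(* What remains is a finite check against the table of [phi]. *)
move: tn kn; case: k k3 {dk} => [|[|[|//]]] _; rewrite ?addr0 ?sE1 ?sE2;
  by case: (s13 (cuts d n)) (d13 (cuts d n)) (d213 n) => -> [] -> [] ->;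
    case: (t).
Qed.

Lemma size_phi_code t s l : l = 1%N \/ l = 3%N -> size (phi t (code s l)) = l.
Proof. by rewrite /code => -[] -> /=; case: ifP; case: t. Qed.

(** The first letter of the defining block decides: [LA] and [LD] code blocks whose symbol equals
    their length, [LB] and [LC] those where it does not. *)
Lemma has_type_start y t : has_type y t -> exists x,
  [/\ smooth x, rec x = y & exists n, let a := cuts (delta x) n in
    (x (cuts x a) == delta x a) = ~~ t].
Proof.
have block w : elementary_block y w -> exists x,
    [/\ smooth x, rec x = y & exists n, let a := cuts (delta x) n in
      head LA w = code (x (cuts x a)) (delta x a)].
  move=> [x [a [b [sx yE B ->]]]]; exists x; split => //.
  have [_ fd] := sx 1%N; have [_ cB] := cutsP fd.
  have [] := increasing_int_cover (cuts (delta x)) _ a.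
    by move=> n; case: (cB n).
  move=> n na; exists n.
  have [ab _ _ _] := B.
  have [-> _] := mono_block_unique (cB n) B na ltac:(lia).
  rewrite -yE /factor; have : (0 < `|b - a|)%N by lia.
  by case: `|b - a|%N => //= l _; rewrite addr0.
have conv w : elementary_block y w ->
    (forall s l, s = 1%N \/ s = 3%N -> l = 1%N \/ l = 3%N ->
      head LA w = code s l -> (s == l) = ~~ t) ->
    exists x, [/\ smooth x, rec x = y & exists n, let a := cuts (delta x) n in
      (x (cuts x a) == delta x a) = ~~ t].
  move=> /block[x [sx yE [n hn]]] wt; exists x; split => //; exists n.
  have [x13 _] := sx 0%N; have [d13 _] := sx 1%N.
  exact: wt (x13 _) (d13 _) hn.
rewrite /has_type; case: t conv => conv [] /conv; apply=> s l;
  by case=> -> [] ->.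
Qed.

Lemma has_type_subst y t : has_type y t -> exists2 i, (i < 3)%N &
  y = iter i (@shift letter) (subst t (deltaY y)).
Proof.
move=> /has_type_start[x [sx <- start]]; rewrite deltaY_rec //.
have [_ fd] := sx 1%N; have [d213 _] := sx 2%N.
rewrite /= in fd d213; set d := delta x.
have sizeE n : size (phi t (rec d n)) = delta d n by exact: size_phi_code.
have [/andP[c0 c1] _] := cutsP fd; rewrite -/d in c0 c1.
(* Index 0 lies in the elementary block that starts at [cuts d 0] and has length at most 3, so it is
   at most 2 past that start. *)
exists `|cuts d 0|%N.
  by have := cuts_delta d 0 fd; rewrite add0r; case: (d213 0) => ->; lia.
apply/funext => i; rewrite iter_shift.
rewrite -(@subst_unique t (rec d) (rec x) (cuts d)).
- by congr (rec x _); lia.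
- by move=> n; rewrite sizeE cuts_delta.
- by move=> n k; rewrite sizeE; exact: rec_elementary_block.
Qed.

Theorem proposition2p12 (tau : nat -> bool) (y : int -> letter)
    (hy : Yt tau y) (L : nat) (hL : (1 <= L)%N) :
  exists i : nat,
    (i < 3 ^ L)%N /\
    y = iter i (@shift letter) (substs tau L (iter L deltaY y)).
Proof.
case: hy => _ types; elim: L {hL} => [|L [i [iL yE]]]; first by exists 0%N.
have [j j3 jE] := has_type_subst _ _ (types L).
(* The shift by [j] sits inside the first [L] substitutions; pulled out, it becomes a shift by [k]
   that adds to [i]. *)
have [k kj kE] :=
  substs_iter_shift tau L (subst (tau L) (deltaY (iter L deltaY y))) j.
exists (i + k)%N; split; last by rewrite iterD /= -kE -jE.
have : (3 ^ L * j <= 3 ^ L * 2)%N by rewrite leq_mul2l -ltnS j3 orbT.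
by rewrite expnSr; lia.
Qed.
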